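(* Let $S_m=\langle d_1,\dots,d_m\rangle$, $m\ge2$, be a complete intersection numerical semigroup, with syzygy degrees $e_1,\dots,e_{m-1}$. Then for every integer $p\ge0$ $$K_p=\frac{T_{p+1}(e_1,\dots,e_{m-1})}{p+1}.$$
   Context: A numerical semigroup $S_m=\langle d_1,\dots,d_m\rangle$ is the additive submonoid of $\mathbb{Z}_{\ge 0}$ minimally generated by positive integers $d_1,\dots,d_m$ with $\gcd(d_1,\dots,d_m)=1$. It is a (symmetric) complete intersection if its semigroup ring, as a quotient of a polynomial ring in $m$ variables, is defined by $m-1$ relations; if $e_1,\dots,e_{m-1}$ are their degrees, then $$\sum_{s\in S_m}z^s=\frac{\prod_{j=1}^{m-1}(1-z^{e_j})}{\prod_{i=1}^m(1-z^{d_i})}.$$ Put $\pi_m=\prod_{i=1}^md_i$ and $$\mathbb{C}_n(S_m)=\sum_{j=1}^{m-1}e_j^n-\sum_{1\le r<j\le m-1}(e_j+e_r)^n+\cdots-(-1)^{m-1}\Bigl(\sum_{j=1}^{m-1}e_j\Bigr)^n .$$ The number $K_p$, $p\ge0$, is defined by $\mathbb{C}_{m+p}(S_m)=\frac{(-1)^m(m+p)!}{p!}\pi_mK_p$. (It is known that $\pi_m=\prod_{j=1}^{m-1}e_j$.) The symmetric polynomials $T_r(x_1,\dots,x_N)$ of degree $r\ge 0$ are defined by the (known) factorization, for $n\ge N$, $$\sum_{j}x_j^n-\sum_{j>r}(x_j+x_r)^n+\sum_{j>r>i}(x_j+x_r+x_i)^n-\cdots-(-1)^N\Bigl(\sum_{j=1}^Nx_j\Bigr)^n=\frac{(-1)^{N+1}n!}{(n-N)!}\Bigl(\prod_{j=1}^Nx_j\Bigr)T_{n-N}(x_1,\dots,x_N),$$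 so $T_0=1$, $T_1=\frac12\sum_j x_j$, etc. *)

(* Defs.v *)
From HB Require Import structures.
From mathcomp Require Import all_boot all_order all_algebra.
From mathcomp Require Import mpoly.

Set Implicit Arguments.
Unset Strict Implicit.
Unset Printing Implicit Defensive.

Import GRing.Theory.
Local Open Scope ring_scope.

(** Numerical semigroups *)

(* [s] lies in the additive submonoid generated by the [d i] with [i] in [A]. *)
Definition generated (m : nat) (d : 'I_m -> nat) (A : {set 'I_m}) (s : nat)
    : Prop :=
  exists a : 'I_m -> nat, s = (\sum_(i in A) a i * d i)%N.

(* The submonoid of [nat] generated by all the [d i] is a numerical semigroup
   of which no proper subfamily of [d] is a system of generators. *)
Definition numerical_semigroup (m : nat) (d : 'I_m -> nat) : Prop :=
  [/\ forall i, (0 < d i)%N,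
      \big[gcdn/0%N]_(i < m) d i = 1%N
    & forall A : {set 'I_m}, A \proper [set: 'I_m] ->
        ~ (forall s, generated d [set: 'I_m] s -> generated d A s)].

(** Semigroup rings and complete intersections *)

(* The semigroup ring k[S] is the ring of the polynomials in one variable whose
   exponents lie in S; it is the image of the morphism X_i |-> X^(d i) (see
   [semigroup_map_image]), whose kernel is thus the ideal of relations. *)
Definition semigroup_map (k : fieldType) (m : nat) (d : 'I_m -> nat)
    (q : {mpoly k[m]}) : {poly k} :=
  mmap (@polyC k) (fun i => 'X^(d i)) q.

Definition weight (m : nat) (d : 'I_m -> nat) (u : 'X_{1..m}) : nat :=
  (\sum_(i < m) u i * d i)%N.

Definition whomogeneous (k : fieldType) (m : nat) (d : 'I_m -> nat) (n : nat)
    (q : {mpoly k[m]}) : Prop :=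
  forall u : 'X_{1..m}, u \in msupp q -> weight d u = n.

(* [f j] is nonzero because 0 is homogeneous of every degree. *)
Definition complete_intersection (k : fieldType) (m : nat) (d : 'I_m -> nat)
    (e : 'I_m.-1 -> nat) : Prop :=
  exists f : 'I_m.-1 -> {mpoly k[m]},
    [/\ forall j, f j != 0,
        forall j, whomogeneous d (e j) (f j)
      & forall q : {mpoly k[m]},
          semigroup_map d q = 0 <->
          exists c : 'I_m.-1 -> {mpoly k[m]}, q = \sum_j c j * f j].

Lemma semigroup_map_image (k : fieldType) (m : nat) (d : 'I_m -> nat)
    (g : {poly k}) :
  (exists q : {mpoly k[m]}, semigroup_map d q = g) <->
  (forall n, g`_n != 0 -> generated d [set: 'I_m] n).
Proof.
have monE (u : 'X_{1..m}) :
    mmap1 (fun i => 'X^(d i)) u = 'X^(weight d u) :> {poly k}.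
  rewrite /mmap1 /weight; under eq_bigr do rewrite -exprM mulnC.
  by elim/big_ind2: _ => [|a x b y -> ->|//]; rewrite ?expr0 ?exprD.
split=> [[q <-] n|H].
  rewrite /semigroup_map /mmap coef_sum => nz.
  have [u _ Hu] : exists2 u, u \in msupp q & weight d u = n.
    have [/hasP[u uq /eqP]|/hasPn no] := boolP (has (fun u => weight d u == n) (msupp q)).
      by exists u.
    case/eqP: nz; rewrite big_seq big1 // => u uq.
    by rewrite monE coefCM coefXn eq_sym (negbTE (no _ uq)) mulr0.
  by exists (fun i => u i); rewrite -Hu /weight; apply: eq_bigl => i; rewrite inE.
have HH (n : nat) : exists q : {mpoly k[m]}, semigroup_map d q = g`_n *: 'X^n.
  have [z|/H[a an]] := eqVneq g`_n 0.
    by exists 0; rewrite /semigroup_map mmap0 z scale0r.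
  exists (g`_n *: 'X_[[multinom a i | i < m]]).
  rewrite /semigroup_map mmapZ mmapX monE mul_polyC; congr (_ *: 'X^_).
  rewrite an /weight; apply: eq_big => i; rewrite ?inE // => _.
  by rewrite mnmE.
suff [q Hq] : exists q : {mpoly k[m]},
    semigroup_map d q = \sum_(i < size g) g`_i *: 'X^i.
  by exists q; rewrite Hq -poly_def coefK.
elim: (size g) => [|n [q IH]].
  by exists 0; rewrite /semigroup_map mmap0 big_ord0.
have [q' Hq'] := HH n.
by exists (q + q'); rewrite /semigroup_map mmapD big_ord_recr /= -IH -Hq'.
Qed.

(** Alternating power sums *)

(* sum_j x_j^n - sum_(j<r) (x_j + x_r)^n + ... - (-1)^N (sum_j x_j)^n *)
Definition alt_power_sum (R : comNzRingType) (N : nat) (x : 'I_N -> R)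
    (n : nat) : R :=
  \sum_(J : {set 'I_N} | J != set0)
     (-1) ^+ #|J|.+1 * (\sum_(j in J) x j) ^+ n.

Lemma sum_sign_supsets (R : comNzRingType) (N : nat) (A : {set 'I_N}) :
  A != [set: 'I_N] ->
  \sum_(J : {set 'I_N} | A \subset J) (-1) ^+ #|J|.+1 = 0 :> R.
Proof.
rewrite -subTset => /subsetPn[a _ aA].
rewrite (bigID (fun J : {set 'I_N} => a \in J)) /=.
rewrite (reindex_onto (fun J => a |: J) (fun J => J :\ a)) /=; last first.
  by move=> J /andP[_ aJ]; rewrite setD1K.
rewrite (eq_bigl (fun J : {set 'I_N} => (A \subset J) && (a \notin J))); last first.
  move=> J; rewrite setU11 andbT; apply/andP/andP => -[].
    move=> AJ /eqP E; have aJ : a \notin J by rewrite -E !inE eqxx.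
    by split=> //; rewrite -E subsetD1 AJ.
  by move=> AJ aJ; rewrite setU1K // eqxx (subset_trans AJ) ?subsetUr.
rewrite -big_split big1 //= => J /andP[_ aJ].
by rewrite cardsU1 aJ exprS mulN1r addNr.
Qed.

Lemma alt_power_sumE (R : comNzRingType) (N : nat) (x : 'I_N -> R) (n : nat) :
  (0 < n)%N ->
  alt_power_sum x n =
  \sum_(h : {ffun 'I_n -> 'I_N} | [set h i | i in 'I_n] == setT)
     (-1) ^+ N.+1 * \prod_i x (h i).
Proof.
move=> n_gt0; rewrite /alt_power_sum.
have powE (J : {set 'I_N}) : (\sum_(j in J) x j) ^+ n =
    \sum_(h : {ffun 'I_n -> 'I_N} | [set h i | i in 'I_n] \subset J)
       \prod_i x (h i).
  rewrite -[in LHS](card_ord n) -prodr_const bigA_distr_big /=.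
  apply: eq_bigl => h; apply/ffun_onP/subsetP => [H y /imsetP[i _ ->] //|H i].
  by apply: H; apply: imset_f.
under eq_bigr do rewrite powE big_distrr /=.
rewrite (exchange_big_dep xpredT) //= [RHS]big_mkcond /=.
apply: eq_bigr => h _.
rewrite -big_distrl /=.
under eq_bigl => J.
  have -> : (J != set0) && ([set h i | i in 'I_n] \subset J) =
            ([set h i | i in 'I_n] \subset J).
    case: eqP => [->|//]; rewrite subset0; apply/esym/negbTE/set0Pn.
    by exists (h (Ordinal n_gt0)); apply: imset_f.
  over.
case: ifPn => [/eqP ->|nT]; last by rewrite sum_sign_supsets ?mul0r.
rewrite (eq_bigl (pred1 setT)) ?big_pred1_eq ?cardsT ?card_ord // => J /=.
by rewrite subTset.
Qed.

Lemma T_exists (N r : nat) : exists q : {mpoly rat[N]},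
  alt_power_sum (fun j => 'X_j : {mpoly rat[N]}) (r + N) ==
  ((-1) ^+ N.+1 * ((r + N)`!%:R / r`!%:R)) *: ((\prod_(j < N) 'X_j) * q).
Proof.
case: (posnP N) => [N0|N_gt0].
  exists 0; rewrite mulr0 scaler0 /alt_power_sum big1 // => J /set0Pn[j].
  by move: (ltn_ord j); rewrite {2}N0.
set c : rat := _ * _.
have c0 : c != 0.
  rewrite mulf_neq0 ?signr_eq0 // mulf_neq0 ?invr_eq0 //.
    by rewrite Num.Theory.pnatr_eq0 -lt0n fact_gt0.
  by rewrite Num.Theory.pnatr_eq0 -lt0n fact_gt0.
pose mult (h : {ffun 'I_(r + N) -> 'I_N}) j := #|[set i | h i == j]|.
exists (c^-1 *: \sum_(h : {ffun 'I_(r + N) -> 'I_N}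
                         | [set h i | i in 'I_(r + N)] == setT)
           (-1) ^+ N.+1 * \prod_j 'X_j ^+ (mult h j).-1).
rewrite -scalerAr scalerA mulfV // scale1r mulr_sumr.
rewrite alt_power_sumE ?addn_gt0 ?N_gt0 ?orbT //.
apply/eqP/eq_bigr => h /eqP hT.
rewrite [RHS]mulrCA; congr (_ * _); rewrite -big_split /=.
rewrite (partition_big h xpredT) //=; apply: eq_bigr => j _.
rewrite (eq_bigr (fun=> 'X_j)) => [|i /eqP -> //].
rewrite prodr_const -exprS prednK ?/mult cardsE //.
have /imsetP[i _ ji] : j \in [set h i | i in 'I_(r + N)] by rewrite hT.
by apply/card_gt0P; exists i; rewrite ji; apply: eqxx.
Qed.

(* The polynomial defined by the factorization for the exponent n = r + N; see
   [T_factorization] and [T_unique]. *)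
Definition T (N r : nat) : {mpoly rat[N]} := xchoose (T_exists N r).

Lemma T_factorization (N n : nat) : (N <= n)%N ->
  alt_power_sum (fun j => 'X_j : {mpoly rat[N]}) n =
  ((-1) ^+ N.+1 * (n`!%:R / (n - N)`!%:R)) *:
    ((\prod_(j < N) 'X_j) * T N (n - N)).
Proof. by move=> Nn; have /eqP := xchooseP (T_exists N (n - N)); rewrite -/(T N _) subnK. Qed.

Lemma T_unique (N r : nat) (q : {mpoly rat[N]}) :
  alt_power_sum (fun j => 'X_j : {mpoly rat[N]}) (r + N) =
  ((-1) ^+ N.+1 * ((r + N)`!%:R / r`!%:R)) *: ((\prod_(j < N) 'X_j) * q) ->
  q = T N r.
Proof.
have := T_factorization (leq_addl r N); rewrite addnK => ->.
have f0 n : n`!%:R != 0 :> rat by rewrite Num.Theory.pnatr_eq0 -lt0n fact_gt0.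
have c0 : (-1) ^+ N.+1 * ((r + N)`!%:R / r`!%:R) != 0 :> rat.
  by rewrite mulf_neq0 ?signr_eq0 // mulf_neq0 ?invr_eq0.
move=> /(congr1 (fun y => (_ : rat)^-1 *: y)).
move=> /(_ ((-1) ^+ N.+1 * ((r + N)`!%:R / r`!%:R))).
rewrite !scalerA mulVf // !scale1r => /mulfI -> //.
by apply/prodf_neq0 => j _; rewrite -msupp_eq0 msuppX.
Qed.

(** The numbers K_p *)

Definition CC (m : nat) (e : 'I_m.-1 -> nat) (n : nat) : rat :=
  alt_power_sum (fun j => (e j)%:R) n.

Definition pi_ (m : nat) (d : 'I_m -> nat) : rat := (\prod_(i < m) d i)%N%:R.

(* The solution of CC_(m+p) = (-1)^m (m+p)! / p! * pi_m * K_p; see [KE]. *)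
Definition K (m : nat) (d : 'I_m -> nat) (e : 'I_m.-1 -> nat) (p : nat) : rat :=
  CC e (m + p) / ((-1) ^+ m * ((m + p)`!%:R / p`!%:R) * pi_ d).

Lemma KE (m : nat) (d : 'I_m -> nat) (e : 'I_m.-1 -> nat) (p : nat) :
  (forall i, (0 < d i)%N) ->
  CC e (m + p) = (-1) ^+ m * ((m + p)`!%:R / p`!%:R) * pi_ d * K d e p.
Proof.
move=> d_gt0; rewrite mulrC divfK //.
have f0 n : n`!%:R != 0 :> rat by rewrite Num.Theory.pnatr_eq0 -lt0n fact_gt0.
rewrite mulf_neq0 //; last by rewrite Num.Theory.pnatr_eq0 -lt0n prodn_gt0.
by rewrite mulf_neq0 ?signr_eq0 // mulf_neq0 ?invr_eq0.
Qed.

(* Main.v *)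
(** By the defining factorization of [T], the formula amounts to
    [\prod_j e j = \prod_i d i], which is obtained from two inequalities.
    (<=) Modulo the relations every homogeneous polynomial of degree [s] is a
    scalar multiple of one monomial, so the polynomial ring is spanned, over the ring
    generated by the [f j], by one element in each degree.  Hence there are at
    most as many [u] with [\sum_i u i * d i <= N] as there are [(w, s)] with
    [\sum_j w j * e j + s <= N]; these numbers grow like
    [N^m / (m! \prod_i d i)] and [N^m / (m! \prod_j e j)].
    (>=) In fact [\prod_i d i] divides [\prod_j e j]: for every [t > 1], at least
    as many of the [e j] as of the [d i] are multiples of [t].  Let [A] be the
    set of the [i] with [d i] not a multiple of [t]; it is nonempty since the
    gcd is 1.  If [e j] is not a multiple of [t], every monomial of [f j]
    involves a variable indexed by [A].  So the ideal generated by these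
    variables and by the remaining [f j] contains all relations and a variable,
    and has finite codimension; by the same count of monomials it has at least
    [m] generators. *)

Require Import Defs.
From HB Require Import structures.
From mathcomp Require Import all_boot all_order all_algebra.
From mathcomp Require Import mpoly.
From mathcomp Require Import zify ring.

Set Implicit Arguments.
Unset Strict Implicit.
Unset Printing Implicit Defensive.

Import GRing.Theory.
Local Open Scope ring_scope.

(** * Weighted homogeneous components *)

Section Weight.
Variables (k : fieldType) (m : nat) (d : 'I_m -> nat).
Implicit Types (u v : 'X_{1..m}) (p q : {mpoly k[m]}).

Lemma weightD u v : weight d (u + v)%MM = (weight d u + weight d v)%N.
Proof.
by rewrite -big_split; apply: eq_bigr => i _; rewrite mnmDE mulnDl.
Qed.

Lemma weightUn i n : weight d (U_(i) *+ n)%MM = (n * d i)%N.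
Proof.
rewrite /weight (bigD1 i) //= mulmnE mnm1E eqxx mul1n big1 ?addn0 // => j ji.
by rewrite mulmnE mnm1E eq_sym (negbTE ji).
Qed.

Lemma weightU i : weight d U_(i)%MM = d i.
Proof. by rewrite -[U_(i)%MM]mulm1n weightUn mul1n. Qed.

Lemma mcoeff_whomogeneous n q u :
  whomogeneous d n q -> weight d u != n -> q@_u = 0.
Proof.
move=> hq; apply: contraNeq; rewrite -mcoeff_msupp => uq.
by apply/eqP/hq.
Qed.

Lemma whomogeneousX u : whomogeneous d (weight d u) ('X_[u] : {mpoly k[m]}).
Proof. by move=> v; rewrite msuppX inE => /eqP ->. Qed.

Lemma whomogeneous0 n : whomogeneous d n (0 : {mpoly k[m]}).
Proof. by move=> u; rewrite msupp0. Qed.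

Definition wpart n q : {mpoly k[m]} :=
  \sum_(u <- msupp q | weight d u == n) q@_u *: 'X_[u].

Lemma mcoeff_wpart n q u : (wpart n q)@_u = if weight d u == n then q@_u else 0.
Proof.
rewrite /wpart raddf_sum /=.
have [uq|uq] := boolP (u \in msupp q); last first.
  rewrite (memN_msupp_eq0 uq) if_same big_seq_cond big1 // => v /andP[vq _].
  rewrite mcoeffZ mcoeffX; case: eqP => [vu|_]; last by rewrite mulr0.
  by rewrite -vu vq in uq.
rewrite big_mkcond (bigD1_seq u) ?msupp_uniq //= mcoeffZ mcoeffX eqxx mulr1.
rewrite big1 ?addr0 // => v vu.
by rewrite mcoeffZ mcoeffX (negbTE vu) mulr0 if_same.
Qed.

Lemma wpart_whomogeneous n q : whomogeneous d n (wpart n q).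
Proof. by move=> u; rewrite mcoeff_msupp mcoeff_wpart; case: (_ =P n); rewrite ?eqxx. Qed.

Lemma wpart_id n q : whomogeneous d n q -> wpart n q = q.
Proof.
move=> hq; apply/mpolyP => u; rewrite mcoeff_wpart.
by case: ifPn => // un; rewrite (mcoeff_whomogeneous hq un).
Qed.

Lemma wpart_sum n (I : finType) (F : I -> {mpoly k[m]}) :
  wpart n (\sum_i F i) = \sum_i wpart n (F i).
Proof.
apply/mpolyP => u; rewrite mcoeff_wpart !raddf_sum /=.
by case: ifP => un; [|symmetry; apply: big1 => i _]; [apply: eq_bigr => i _|];
  rewrite mcoeff_wpart un.
Qed.

Lemma wpartD n p q : wpart n (p + q) = wpart n p + wpart n q.
Proof.
apply/mpolyP => u; rewrite mcoeffD !mcoeff_wpart mcoeffD.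
by case: ifP; rewrite ?addr0.
Qed.

(** All monomials of [q] have weight [e], so the weight of a product monomial fixes that of its left
    factor. The test [e <= n] guards the truncated subtraction. *)
Lemma wpartM n e p q : whomogeneous d e q ->
  wpart n (p * q) = if (e <= n)%N then wpart (n - e)%N p * q else 0.
Proof.
move=> hq; apply/mpolyP => u; rewrite mcoeff_wpart.
have nz (v : 'X_{1..m}) : q@_v != 0 -> weight d v = e.
  by rewrite -mcoeff_msupp; apply: hq.
case: leqP => en; last first.
  rewrite mcoeff0; case: eqP => // un; rewrite mcoeffM big1 // => -[v1 v2] /=.
  move=> /eqP uE; have [->|/nz ev] := eqVneq q@_v2 0; first by rewrite mulr0.
  by move: un; rewrite (congr1 (weight d) uE) weightD ev; lia.
rewrite !mcoeffM; case: eqP => un; [|symmetry; apply: big1 => -[v1 v2] /=].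
  apply: eq_bigr => -[v1 v2] /= /eqP uE.
  have [->|/nz ev] := eqVneq q@_v2 0; first by rewrite !mulr0.
  rewrite mcoeff_wpart; move: un; rewrite (congr1 (weight d) uE) weightD ev => <-.
  by rewrite addnK eqxx.
move=> /eqP uE; have [->|/nz ev] := eqVneq q@_v2 0; first by rewrite mulr0.
rewrite mcoeff_wpart; case: eqP => [v1E|_]; last by rewrite mul0r.
by case: un; rewrite (congr1 (weight d) uE) weightD ev v1E subnK.
Qed.

End Weight.

(** * Comparing monomials with a spanning family *)

Section Counting.
Variables (k : fieldType) (m : nat) (d : 'I_m -> nat).
Variables (I : finType) (g : I -> {mpoly k[m]}) (e : I -> nat).
Hypothesis e_gt0 : forall t, (0 < e t)%N.
Hypothesis hg : forall t, whomogeneous d (e t) (g t).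
Variables (b : nat -> {mpoly k[m]}) (B : pred nat).
Hypothesis hb : forall n, whomogeneous d n (b n).
Hypothesis gen : forall n q, whomogeneous d n q ->
  exists (c : k) (a : I -> {mpoly k[m]}), q = (c *+ B n) *: b n + \sum_t a t * g t.

Definition lattice_points N : {set {ffun 'I_m -> 'I_N.+1}} :=
  [set u : {ffun 'I_m -> 'I_N.+1} | (\sum_i u i * d i <= N)%N].

(** These index products of powers of the [g t] with one [b n]. [B] marks the degrees where [b] may
    contribute: all of them for the product formula, finitely many for a finite-dimensional
    quotient. *)
Definition span_points N : {set {ffun I -> 'I_N.+1} * 'I_N.+1} :=
  [set x : {ffun I -> 'I_N.+1} * 'I_N.+1 |
     (\sum_t x.1 t * e t + x.2 <= N)%N && B x.2].

Let gpow (w : I -> nat) := \prod_t g t ^+ w t.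

Let spanned N q := exists c : {ffun {ffun I -> 'I_N.+1} * 'I_N.+1 -> k},
  q = \sum_(x in span_points N) c x *: (gpow (fun t => x.1 t) * b x.2).

Let spannedD N p q : spanned N p -> spanned N q -> spanned N (p + q).
Proof.
move=> [c ->] [c' ->]; exists [ffun x => c x + c' x].
by rewrite -big_split; apply: eq_bigr => x _; rewrite ffunE scalerDl.
Qed.

Let spannedZ N a q : spanned N q -> spanned N (a *: q).
Proof.
move=> [c ->]; exists [ffun x => a * c x].
by rewrite scaler_sumr; apply: eq_bigr => x _; rewrite ffunE scalerA.
Qed.

Let spanned0 N : spanned N 0.
Proof. by exists [ffun=> 0]; rewrite big1 // => x _; rewrite ffunE scale0r. Qed.

Let spanned_gen N (w : I -> nat) n :
  (\sum_t w t * e t + n <= N)%N -> B n -> spanned N (gpow w * b n).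
Proof.
move=> le_N Bn.
have nN : (n < N.+1)%N by rewrite ltnS (leq_trans _ le_N) // leq_addl.
have wN t : (w t < N.+1)%N.
  rewrite ltnS (leq_trans _ le_N) // (bigD1 t) //= -!addnA.
  by rewrite (leq_trans _ (leq_addr _ _)) // leq_pmulr.
pose x := ([ffun t => Ordinal (wN t)], Ordinal nN).
exists [ffun y => (y == x)%:R].
have xin : x \in span_points N.
  rewrite inE /= Bn andbT; apply: leq_trans le_N; rewrite leq_add2r.
  by apply: eq_leq; apply: eq_bigr => t _; rewrite ffunE.
rewrite (bigD1 x) //= big1 ?addr0 => [|y /andP[_ /negbTE yx]]; last first.
  by rewrite ffunE yx scale0r.
rewrite ffunE eqxx scale1r /gpow; congr (_ * _).
by apply: eq_bigr => t _; rewrite ffunE.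
Qed.

(** Strong induction on the degree: each [g t] produced by [gen] is absorbed into [w], and its
    cofactor has degree [n - e t], which is smaller since [e t] is positive. *)
Let spanned_whomogeneous N n q (w : I -> nat) : whomogeneous d n q ->
  (\sum_t w t * e t + n <= N)%N -> spanned N (gpow w * q).
Proof.
elim/ltn_ind: n q w => n IH q w hq le_N.
have [c [a qE]] := gen hq.
(* The cofactors from [gen] need not be homogeneous; taking the part of weight [n] makes them so. *)
have -> : q = (c *+ B n) *: b n +
    \sum_t (if (e t <= n)%N then wpart d (n - e t)%N (a t) * g t else 0).
  rewrite -[LHS](wpart_id hq) qE wpartD wpart_sum; congr (_ + _).
    rewrite wpart_id // => u uq; apply: (hb (n := n)).
    by apply: msuppZ_le uq.
  by apply: eq_bigr => t _; rewrite (wpartM _ _ (@hg t)).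
rewrite mulrDr; apply: spannedD.
  rewrite -scalerAr; have [Bn|_] := boolP (B n).
    by apply: spannedZ; apply: spanned_gen.
  by rewrite mulr0n scale0r.
rewrite mulr_sumr; elim/big_rec: _ => // t p _; apply: spannedD.
case: leqP => en; last by rewrite mulr0.
have -> : gpow w * (wpart d (n - e t)%N (a t) * g t) =
    gpow (fun s => (w s + (s == t))%N) * wpart d (n - e t)%N (a t).
  rewrite mulrCA mulrC; congr (_ * _); rewrite /gpow.
  under [RHS]eq_bigr do rewrite exprD.
  rewrite big_split /=; congr (_ * _).
  rewrite (bigD1 t) //= eqxx expr1 big1 ?mulr1 // => s /negbTE ->.
  by rewrite expr0.
apply: (IH (n - e t)%N).
- by rewrite ltn_subrL e_gt0 (leq_trans (e_gt0 t) en).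
- exact: wpart_whomogeneous.
under eq_bigr do rewrite mulnDl.
rewrite big_split /= (_ : \sum_s (s == t) * e s = e t)%N.
  by rewrite -addnA subnKC.
rewrite (bigD1 t) //= eqxx mul1n big1 ?addn0 // => s /negbTE ->.
by rewrite mul0n.
Qed.

(** Distinct monomials are linearly independent, and those of weight at most [N] lie in the span of
    the products indexed by [span_points N]. *)
Lemma card_lattice_points_le N :
  (#|lattice_points N| <= #|span_points N|)%N.
Proof.
pose mon (u : {ffun 'I_m -> 'I_N.+1}) := [multinom nat_of_ord (u i) | i < m].
have mon_inj : injective mon.
  move=> u v /mnmP uv; apply/ffunP => i; apply/val_inj.
  by have := uv i; rewrite !mnmE.
have span_mon (u : {ffun 'I_m -> 'I_N.+1}) :
    exists c : {ffun {ffun I -> 'I_N.+1} * 'I_N.+1 -> k}, u \in lattice_points N ->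
  'X_[mon u] = \sum_(x in span_points N) c x *: (gpow (fun t => x.1 t) * b x.2).
  case: (boolP (u \in lattice_points N)) => [uN|_]; last by exists [ffun=> 0].
  have [|c cE] := @spanned_whomogeneous N _ 'X_[mon u] (fun=> 0%N)
    (@whomogeneousX _ _ _ _).
    rewrite big1 => [|t _]; last by rewrite mul0n.
    rewrite inE in uN; rewrite add0n (leq_trans _ uN) //.
    by apply: eq_leq; apply: eq_bigr => i _; rewrite mnmE.
  have gpow0 : gpow (fun=> 0%N) = 1 by apply: big1 => t _; rewrite expr0.
  by exists c => _; rewrite -cE gpow0 mul1r.
have [c cE] := fin_all_exists span_mon.
(* [A] writes the monomials in terms of the products and [C] reads off monomial coefficients. As
   [A *m C] is the identity, the rank of [A] bounds its number of columns from below. *)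
pose A := \matrix_(i < #|lattice_points N|, j < #|span_points N|)
  c (enum_val i) (enum_val j).
pose C := \matrix_(j < #|span_points N|, i < #|lattice_points N|)
  (gpow (fun t => (enum_val j).1 t) * b (enum_val j).2)@_(mon (enum_val i)).
have AC : A *m C = 1%:M.
  apply/matrixP => i i'; rewrite !mxE.
  have := congr1 (mcoeff (mon (enum_val i'))) (cE _ (enum_valP i)).
  rewrite mcoeffX (inj_eq mon_inj) (inj_eq enum_val_inj) => ->.
  rewrite raddf_sum [RHS]big_enum_val /=; apply: eq_bigr => j _.
  by rewrite !mxE mcoeffZ.
rewrite -(mxrank1 k #|lattice_points N|) -AC.
by rewrite (leq_trans (mxrankM_maxl _ _)) // rank_leq_col.
Qed.

End Counting.

(** * Lattice point counts and their growth *)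

Local Open Scope nat_scope.

Lemma card_ord_ltn n a : #|[pred i : 'I_n | i < a]| = minn n a.
Proof.
rewrite -sum1_card big_mkcond /=.
elim: n => [|n IH]; first by rewrite big_ord0 min0n.
by rewrite big_ord_recr /= IH inE /=; case: (ltnP n a) => na; lia.
Qed.

(** The sum serves only as a common bound, so that all coordinates live in one ordinal type. *)
Definition residues (I : finType) (e : I -> nat) :=
  [set r : {ffun I -> 'I_(\sum_i e i).+1} | [forall i, r i < e i]].

Lemma card_residues (I : finType) (e : I -> nat) : #|residues e| = \prod_i e i.
Proof.
rewrite (eq_card (B := family (fun i => [pred j : 'I_(\sum_i e i).+1 | j < e i]))).
  rewrite card_family foldrE big_image /=; apply: eq_bigr => i _.
  rewrite card_ord_ltn; apply/minn_idPr/leqW.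
  by rewrite (bigD1 i) //= leq_addr.
by move=> r; rewrite inE; apply/forallP/familyP => rP i; apply: rP.
Qed.

(** The binomial counts the [m]-tuples of sum at most [N]. Dividing each entry by [d i] injects them
    into pairs of a lattice point of quotients and a vector of remainders. *)
Lemma bin_le_lattice_points m (d : 'I_m -> nat) N : (forall i, 0 < d i) ->
  'C(m + N, m) <= \prod_i d i * #|lattice_points d N|.
Proof.
move=> d_gt0.
rewrite -card_partial_ord_partitions mulnC -card_residues -cardsX.
pose phi (t : m.-tuple 'I_N.+1) : {ffun 'I_m -> 'I_N.+1} *
    {ffun 'I_m -> 'I_(\sum_i d i).+1} :=
  ([ffun i => inord (tnth t i %/ d i)], [ffun i => inord (tnth t i %% d i)]).
have phi1 t i : (phi t).1 i = tnth t i %/ d i :> nat.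
  by rewrite ffunE inordK // (leq_ltn_trans (leq_div _ _)).
have phi2 t i : (phi t).2 i = tnth t i %% d i :> nat.
  rewrite ffunE inordK // ltnS (leq_trans (ltnW (ltn_pmod _ (d_gt0 i)))) //.
  by rewrite (bigD1 i) //= leq_addr.
have phi_inj : injective phi.
  move=> t t' tt'; apply: eq_from_tnth => i; apply: val_inj => /=.
  by rewrite (divn_eq (tnth t i) (d i)) (divn_eq (tnth t' i) (d i)) -!phi1 -!phi2 tt'.
rewrite -(card_imset _ phi_inj); apply/subset_leq_card/subsetP => _ /imsetP[t tN ->].
rewrite inE big_tuple in tN; rewrite !inE; apply/andP; split.
  apply: leq_trans tN; apply: leq_sum => i _.
  by rewrite phi1 leq_divM.
by apply/forallP => i; rewrite phi2 ltn_pmod.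
Qed.

(** Division read backwards: quotients and remainders recombine injectively into a tuple whose entry
    0 is the degree of [b]. The remainders raise the sum by at most [\sum_j e j]. *)
Lemma span_points_le_bin r (e : 'I_r -> nat) N : (forall j, 0 < e j) ->
  \prod_j e j * #|span_points e predT N| <= 'C(r.+1 + (N + \sum_j e j), r.+1).
Proof.
move=> e_gt0; set E := \sum_j e j.
rewrite -card_partial_ord_partitions mulnC -card_residues -cardsX.
pose phi (x : {ffun 'I_r -> 'I_N.+1} * 'I_N.+1 * {ffun 'I_r -> 'I_E.+1}) :
    r.+1.-tuple 'I_(N + E).+1 :=
  [tuple if unlift ord0 i is Some j then inord (x.1.1 j * e j + x.2 j)
         else inord x.1.2 | i < r.+1].
set D := setX _ _.
have DP x : x \in D -> \sum_j (x.1.1 j * e j + x.2 j) + x.1.2 <= N + E.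
  rewrite !inE andbT => /andP[xN /forallP xE].
  rewrite big_split /= -addnA [_ + x.1.2]addnC addnA leq_add //.
  by apply: leq_sum => j _; apply: ltnW.
have phi0 x : x \in D -> tnth (phi x) ord0 = x.1.2 :> nat.
  move=> /DP xN; rewrite tnth_mktuple unlift_none inordK // ltnS.
  by apply: leq_trans xN; rewrite leq_addl.
have phiS x j : x \in D ->
    tnth (phi x) (lift ord0 j) = x.1.1 j * e j + x.2 j :> nat.
  move=> /DP xN; rewrite tnth_mktuple liftK inordK // ltnS.
  by apply: leq_trans xN; rewrite (bigD1 j) //= -!addnA addnA leq_addr.
have phi_inj : {in D &, injective phi}.
  move=> x y xD yD xy.
  have xy0 : x.1.2 = y.1.2 by apply: val_inj; rewrite /= -phi0 // xy phi0.
  have xyS j : x.1.1 j = y.1.1 j /\ x.2 j = y.2 j.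
    have := phiS _ j xD; rewrite xy phiS // => xyj.
    have lt z : z \in D -> z.2 j < e j.
      by rewrite !inE => /andP[_ /forallP].
    split; apply: val_inj => /=.
      have := congr1 (divn^~ (e j)) xyj.
      by rewrite /= !divnMDl // !divn_small ?lt // !addn0.
    have := congr1 (modn^~ (e j)) xyj.
    by rewrite /= !modnMDl !modn_small ?lt.
  case: x y xy0 xyS {xD yD xy} => [[x1 x0] x2] [[y1 y0] y2] /= -> xyS.
  have -> : x1 = y1 by apply/ffunP => j; case: (xyS j).
  by have -> : x2 = y2 by apply/ffunP => j; case: (xyS j).
rewrite -(card_in_imset phi_inj).
apply/subset_leq_card/subsetP => _ /imsetP[x xD ->].
rewrite inE big_tuple big_ord_recl phi0 // addnC (leq_trans _ (DP _ xD)) //.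
by rewrite leq_add2r; apply: eq_leq; apply: eq_bigr => j _; rewrite phiS.
Qed.

Lemma expn_le_ffact m N : N.+1 ^ m <= (m + N) ^_ m.
Proof.
elim: m => [|m IH]; first by rewrite expn0 ffactn0.
by rewrite addSn ffactSS expnS leq_mul ?ltnS ?leq_addl.
Qed.

Lemma leq_expn2rW m a b : a <= b -> a ^ m <= b ^ m.
Proof. by move=> ab; elim: m => // m IH; rewrite !expnS leq_mul. Qed.

Lemma ffact_le_expn n m : n ^_ m <= n ^ m.
Proof.
elim: m n => [|m IH] n //; rewrite ffactnS expnS leq_mul //=.
exact: leq_trans (IH _) (leq_expn2rW _ (leq_pred n)).
Qed.

(** Bernoulli's inequality for [(1 - 1/(y+1))^m], with denominators cleared. *)
Lemma expnS_le_add y m : y.+1 ^ m * y.+1 <= y ^ m * y.+1 + m * y.+1 ^ m.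
Proof.
elim: m => [|m IH]; first by rewrite !expn0; lia.
rewrite !expnS; move: IH; set Y := y.+1 ^ m; set Z := y ^ m; nia.
Qed.

(* For [P < Q] the hypothesis would give [(P+1) * y^m <= P * (y+1)^m], which
   Bernoulli's inequality refutes for large [y]. *)
Lemma le_of_bin_le m P Q E :
  (forall N, Q * 'C(m + N, m) <= P * 'C(m + (N + E), m)) -> Q <= P.
Proof.
move=> H.
have {}H N : Q * N.+1 ^ m <= P * (m + (N + E)) ^ m.
  have := leq_mul (H N) (leqnn m`!); rewrite -!mulnA !bin_ffact => H'.
  apply: leq_trans (leq_mul (leqnn Q) (expn_le_ffact m N)) _.
  apply: leq_trans H' _; rewrite leq_mul2l; apply/orP; right.
  exact: ffact_le_expn.
rewrite leqNgt; apply/negP => PQ.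
(* At [N = F * y - 1] the shift satisfies [m + N + E <= F * y.+1], so [F ^ m] cancels. The value of
   [y] makes Bernoulli's bound contradictory. *)
pose F := (m + E).+1; pose y := (P.+1 * m).+1.
have {}H : P.+1 * y ^ m <= P * y.+1 ^ m.
  have := H (F * y).-1; rewrite prednK ?muln_gt0 // => H'.
  have F_gt0 : 0 < F ^ m by rewrite expn_gt0.
  rewrite -(leq_pmul2l F_gt0) mulnCA [F ^ m * (P * _)]mulnCA -!expnMn.
  apply: leq_trans (leq_mul PQ (leqnn _)) _; apply: leq_trans H' _.
  rewrite leq_mul2l; apply/orP; right.
  by apply: leq_expn2rW; rewrite [F * y.+1]mulnS /F; lia.
have := expnS_le_add y m; have : 0 < y.+1 ^ m by rewrite expn_gt0.
move: H; set Y := y.+1 ^ m; set Z := y ^ m => H Y_gt0 B.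
suff : Y * y.+1 <= Y * (P.+1 * m) by rewrite leq_pmul2l // /y; lia.
nia.
Qed.

(* A finite-dimensional quotient of the polynomial ring in [m] variables cannot
   be obtained with fewer than [m] relations. *)
Lemma leq_card_generators (k : fieldType) m (d : 'I_m -> nat) (I : finType)
    (g : I -> {mpoly k[m]}) (e : I -> nat) (b : nat -> {mpoly k[m]}) D :
  (forall i, 0 < d i) -> (forall t, 0 < e t) ->
  (forall t, whomogeneous d (e t) (g t)) -> (forall n, whomogeneous d n (b n)) ->
  (forall n q, whomogeneous d n q -> exists (c : k) (a : I -> {mpoly k[m]}),
     q = (c *+ (n < D)) *: b n + \sum_t a t * g t)%R ->
  m <= #|I|.
Proof.
move=> d_gt0 e_gt0 hg hb gen; rewrite leqNgt; apply/negP => Im.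
have H N : N.+1 ^ m <= m`! * (\prod_i d i) * (N.+1 ^ #|I| * D).
  apply: leq_trans (expn_le_ffact m N) _; rewrite -bin_ffact mulnC -mulnA.
  rewrite leq_pmul2l ?fact_gt0 //; apply: leq_trans (bin_le_lattice_points N d_gt0) _.
  rewrite leq_mul2l; apply/orP; right.
  apply: leq_trans (card_lattice_points_le e_gt0 hg hb gen N) _.
  apply: (@leq_trans #|setX [set: {ffun I -> 'I_N.+1}] [set i : 'I_N.+1 | i < D]|).
    apply/subset_leq_card/subsetP => x; rewrite !inE /=.
    by case/andP.
  rewrite cardsX cardsT card_ffun card_ord leq_mul2l; apply/orP; right.
  by rewrite cardsE card_ord_ltn geq_minr.
(* [H] at [N = C] reads [C.+1 ^ m <= C * C.+1 ^ #|I|], impossible when [#|I| < m]. *)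
pose C := m`! * (\prod_i d i) * D.
have : C.+1 ^ (m - #|I|.+1) * C.+1 * C.+1 ^ #|I| <= C * C.+1 ^ #|I|.
  by rewrite -mulnA -expnS -expnD subnK // (leq_trans (H C)) // mulnCA mulnC.
rewrite leq_pmul2r ?expn_gt0 // leqNgt => /negP; apply.
by rewrite leq_pmull ?expn_gt0.
Qed.

Local Open Scope ring_scope.

(** * Finitely generated ideals *)

Section Ideals.
Variables (R : comNzRingType) (I : finType) (g : I -> R).

Definition ideal_of (q : R) := exists a : I -> R, q = \sum_t a t * g t.

Lemma ideal_ofD p q : ideal_of p -> ideal_of q -> ideal_of (p + q).
Proof.
move=> [a ->] [c ->]; exists (fun t => a t + c t).
by rewrite -big_split; apply: eq_bigr => t _; rewrite mulrDl.
Qed.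

Lemma ideal_ofM p q : ideal_of q -> ideal_of (p * q).
Proof.
move=> [a ->]; exists (fun t => p * a t).
by rewrite mulr_sumr; apply: eq_bigr => t _; rewrite mulrA.
Qed.

Lemma ideal_of_sum (T : eqType) (s : seq T) (F : T -> R) :
  {in s, forall x, ideal_of (F x)} -> ideal_of (\sum_(x <- s) F x).
Proof.
elim: s => [|x s IH] H.
  by exists (fun=> 0); rewrite big_nil big1 // => t _; rewrite mul0r.
rewrite big_cons; apply: ideal_ofD; first by apply: H; rewrite mem_head.
by apply: IH => y ys; apply: H; rewrite inE ys orbT.
Qed.

Lemma ideal_of_gen t : ideal_of (g t).
Proof.
exists (fun s => (s == t)%:R); rewrite (bigD1 t) //= eqxx mul1r.
by rewrite big1 ?addr0 // => s /negbTE ->; rewrite mul0r.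
Qed.

End Ideals.

(** * The semigroup ring and its relations *)

Section SemigroupRing.
Variables (k : fieldType) (m : nat) (d : 'I_m -> nat).
Hypothesis d_gt0 : forall i, (0 < d i)%N.
Implicit Types (u v : 'X_{1..m}) (p q : {mpoly k[m]}).

Lemma mdeg_le_weight u : (mdeg u <= weight d u)%N.
Proof. by rewrite mdegE; apply: leq_sum => i _; rewrite leq_pmulr. Qed.

Lemma semigroup_mapX u : semigroup_map d ('X_[u] : {mpoly k[m]}) = 'X^(weight d u).
Proof.
rewrite /semigroup_map mmapX /mmap1 /weight.
under eq_bigr do rewrite -exprM mulnC.
by elim/big_rec2: _ => [|i a x _ ->]; rewrite ?expr0 ?exprD.
Qed.

Lemma semigroup_map_whomogeneous n q : whomogeneous d n q ->
  exists c : k, semigroup_map d q = c *: 'X^n.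
Proof.
move=> hq; exists (\sum_(u <- msupp q) q@_u).
rewrite scaler_suml {1}[q]mpolyE {1}/semigroup_map raddf_sum /=.
rewrite big_seq [RHS]big_seq; apply: eq_bigr => u uq.
by rewrite mmapZ -/(semigroup_map d 'X_[u]) semigroup_mapX hq // mul_polyC.
Qed.

(** The degree bound makes the search finite and loses nothing, since positive [d i] give
    [mdeg u <= weight d u]. The value is 0 when no monomial has weight [n]. *)
Definition std_monomial n : {mpoly k[m]} :=
  if [pick u : 'X_{1..m < n.+1} | weight d u == n] is Some u then 'X_[u] else 0.

Lemma std_monomialP n :
  (exists2 u, weight d u = n & std_monomial n = 'X_[u]) \/
  (std_monomial n = 0 /\ forall u, weight d u <> n).
Proof.
rewrite /std_monomial; case: pickP => [u /eqP un|none]; first by left; exists u.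
right; split=> // u un; have u_small : (mdeg u < n.+1)%N.
  by rewrite ltnS -un mdeg_le_weight.
by have /eqP := none (BMultinom u_small).
Qed.

Lemma std_monomial_whomogeneous n : whomogeneous d n (std_monomial n).
Proof.
have [[u <- ->]|[-> _]] := std_monomialP n; first exact: whomogeneousX.
exact: whomogeneous0.
Qed.

Lemma std_monomial_mod n q : whomogeneous d n q ->
  exists c : k, semigroup_map d (q - c *: std_monomial n) = 0.
Proof.
move=> hq; have [c qE] := semigroup_map_whomogeneous hq; exists c.
have [[u un ->]|[-> none]] := std_monomialP n.
  rewrite /semigroup_map mmapB mmapZ -/(semigroup_map d q) qE.
  by rewrite -/(semigroup_map d 'X_[u]) semigroup_mapX un mul_polyC subrr.
rewrite scaler0 subr0 [q]mpolyE big_seq big1 ?/semigroup_map ?mmap0 // => u uq.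
by case: (none u); apply: hq.
Qed.

Variables (J : finType) (f : J -> {mpoly k[m]}) (e : J -> nat).
Hypothesis e_gt0 : forall j, (0 < e j)%N.
Hypothesis hf : forall j, whomogeneous d (e j) (f j).
Hypothesis ker_f : forall q, semigroup_map d q = 0 -> ideal_of f q.

(* Setting the variables in [A] to zero kills the [f j] with [j \in S], while
   the quotient of the semigroup ring by one of these variables is already
   finite-dimensional. *)
Lemma leq_card_hit (A : {set 'I_m}) (S : {set J}) : A != set0 ->
  (forall j u, j \in S -> u \in msupp (f j) -> exists2 i, i \in A & u i != 0%N) ->
  (m <= #|A| + #|~: S|)%N.
Proof.
case/set0Pn => i0 i0A hit.
pose I : finType := ({i : 'I_m | i \in A} + {j : J | j \notin S})%type.
pose g (t : I) : {mpoly k[m]} :=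
  match t with inl i => 'X_(val i) | inr j => f (val j) end.
pose eg (t : I) := match t with inl i => d (val i) | inr j => e (val j) end.
have gX (i : 'I_m) : i \in A -> ideal_of g 'X_i.
  by move=> iA; apply: (ideal_of_gen g (inl (exist _ i iA))).
have gf j : ideal_of g (f j).
  have [jS|jS] := boolP (j \in S); last first.
    exact: (ideal_of_gen g (inr (exist _ j jS))).
  rewrite [f j]mpolyE; apply: ideal_of_sum => u uf.
  have [i iA ui] := hit j u jS uf.
  rewrite -mul_mpolyC; apply: ideal_ofM.
  rewrite -(submK (m := U_(i)%MM) (m' := u)) ?lep1mP // mpolyXD.
  by apply: ideal_ofM; apply: gX.
have gker q : semigroup_map d q = 0 -> ideal_of g q.
  move=> /ker_f[a ->]; apply: ideal_of_sum => j _.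
  exact/ideal_ofM/gf.
(* If every exponent were below [d i0], the weight would be less than [D]. *)
pose D := (d i0 * \sum_i d i)%N.
have gstd n : (D <= n)%N -> ideal_of g (std_monomial n).
  move=> Dn; have [[u un ->]|[-> _]] := std_monomialP n; last first.
    by exists (fun=> 0); rewrite big1 // => t _; rewrite mul0r.
  have [/existsP[i ui]|/existsPn none] := boolP [exists i, d i0 <= u i]%N; last first.
    have : (weight d u + \sum_i d i <= D)%N.
      rewrite /weight -big_split /D big_distrr /=; apply: leq_sum => i _.
      by rewrite addnC -mulSn leq_mul2r ltnNge none orbT.
    have : (0 < \sum_i d i)%N by rewrite (bigD1 i0) //= addn_gt0 d_gt0.
    by rewrite un; lia.
  have le_u : (U_(i) *+ d i0 <= u)%MM.
    apply/mnm_lepP => i'; rewrite mulmnE mnm1E.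
    by case: eqP => [<-|_]; rewrite ?mul1n.
  rewrite -(submK le_u) mpolyXD; apply: ideal_ofM.
  (* The powers [X_i^(d i0)] and [X_i0^(d i)] have equal weight, so they differ by a relation, and
     the second is a multiple of the generator [X_i0]. *)
  rewrite -['X_[_]](subrK 'X_[U_(i0) *+ d i]); apply: ideal_ofD.
    apply: gker; rewrite /semigroup_map mmapB -!/(semigroup_map d 'X_[_]).
    by rewrite !semigroup_mapX !weightUn mulnC subrr.
  rewrite -(prednK (d_gt0 i)) mulmSr mpolyXD; apply: ideal_ofM; exact: gX.
have -> : (#|A| + #|~: S| = #|I|)%N.
  rewrite card_sum !card_sig; congr (_ + _)%N; apply: eq_card => x //.
  by rewrite !inE.
have eg_gt0 t : (0 < eg t)%N by case: t => [i|j]; [apply: d_gt0|apply: e_gt0].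
have hg t : whomogeneous d (eg t) (g t).
  case: t => [i|j]; last exact: hf.
  by rewrite /= -{1}weightU; apply: whomogeneousX.
apply: (leq_card_generators (D := D) d_gt0 eg_gt0 hg std_monomial_whomogeneous).
move=> n q hq; have [c /gker[a qE]] := std_monomial_mod hq; exists c.
case: ltnP => nD; first by exists a; rewrite -qE addrC subrK.
have [a' q'E] : ideal_of g q.
  rewrite -[q](subrK (c *: std_monomial n)); apply: ideal_ofD; first by exists a.
  by rewrite -mul_mpolyC; apply/ideal_ofM/gstd.
by exists a'; rewrite mulr0n scale0r add0r.
Qed.

End SemigroupRing.

(** * Divisibility of products by counting multiples *)

Lemma logn_prod (I : finType) (F : I -> nat) p : (forall i, 0 < F i)%N ->
  logn p (\prod_i F i) = (\sum_i logn p (F i))%N.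
Proof.
move=> F_gt0; suff [] : (0 < \prod_i F i)%N /\
  logn p (\prod_i F i)%N = (\sum_i logn p (F i))%N by [].
elim/big_rec2: _ => [|i a x _ [x_gt0 xE]]; first by rewrite logn1.
by rewrite muln_gt0 F_gt0 x_gt0 lognM // xE.
Qed.

Lemma logn_sum_dvd p n N : prime p -> (0 < n <= N)%N ->
  logn p n = (\sum_(i < N) (p ^ i.+1 %| n))%N.
Proof.
move=> p_pr /andP[n_gt0 nN].
have pn : (logn p n < n)%N by rewrite ltn_logl.
rewrite -[LHS](minn_idPr (leq_trans (ltnW pn) nN)) -card_ord_ltn -sum1_card.
by rewrite big_mkcond; apply: eq_bigr => i _; rewrite pfactor_dvdn // inE; case: ifP.
Qed.

(** The exponent of a prime [p] in a product counts the pairs of a factor and a power [p ^ n.+1]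
    dividing it. Exchanging the sums allows comparison one power at a time. *)
Lemma dvdn_prod_of_count (I J : finType) (d : I -> nat) (e : J -> nat) :
  (forall i, 0 < d i)%N -> (forall j, 0 < e j)%N ->
  (forall t, (1 < t)%N ->
     (\sum_i (t %| d i) <= \sum_j (t %| e j))%N) ->
  (\prod_i d i %| \prod_j e j)%N.
Proof.
move=> d_gt0 e_gt0 H.
have e_prod : (0 < \prod_j e j)%N by apply: prodn_gt0.
apply/dvdn_partP => [|p]; first exact: prodn_gt0.
rewrite mem_primes => /andP[p_pr _].
rewrite p_part pfactor_dvdn // !logn_prod //.
pose N := (\sum_i d i + \sum_j e j)%N.
have dN i : (0 < d i <= N)%N by rewrite d_gt0 /N (bigD1 i) //= -!addnA leq_addr.
have eN j : (0 < e j <= N)%N.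
  by rewrite e_gt0 /N addnC (bigD1 j) //= -!addnA leq_addr.
under eq_bigr do rewrite (logn_sum_dvd p_pr (dN _)).
under [X in (_ <= X)%N]eq_bigr do rewrite (logn_sum_dvd p_pr (eN _)).
rewrite exchange_big [X in (_ <= X)%N]exchange_big /=.
apply: leq_sum => n _; apply: H.
by rewrite -[1%N](exp1n n.+1) ltn_exp2r // prime_gt1.
Qed.

(** * The product formula and the value of [K] *)

Lemma prod_relation_degrees (k : fieldType) r (d : 'I_r.+1 -> nat)
    (f : 'I_r -> {mpoly k[r.+1]}) (e : 'I_r -> nat) :
  (forall i, 0 < d i)%N -> (\big[gcdn/0]_i d i = 1)%N ->
  (forall j, 0 < e j)%N -> (forall j, whomogeneous d (e j) (f j)) ->
  (forall q, semigroup_map d q = 0 -> ideal_of f q) ->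
  (\prod_j e j = \prod_i d i)%N.
Proof.
move=> d_gt0 d_gcd e_gt0 hf ker_f; apply/eqP; rewrite eqn_leq; apply/andP; split.
  apply: (@le_of_bin_le r.+1 _ _ (\sum_j e j)) => N.
  apply: (@leq_trans (\prod_j e j * (\prod_i d i * #|lattice_points d N|))).
    by rewrite leq_mul2l bin_le_lattice_points ?orbT.
  rewrite mulnCA leq_mul2l; apply/orP; right.
  apply: leq_trans (span_points_le_bin N e_gt0); rewrite leq_mul2l; apply/orP; right.
  have gen n q : whomogeneous d n q -> exists (c : k) (a : 'I_r -> {mpoly k[r.+1]}),
      q = (c *+ predT n) *: std_monomial k d n + \sum_j a j * f j.
    move=> hq; have [c /ker_f[a qE]] := std_monomial_mod d_gt0 hq.
    by exists c, a; rewrite -qE addrC subrK.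
  exact: (card_lattice_points_le e_gt0 hf (std_monomial_whomogeneous d_gt0) gen N).
have e_prod : (0 < \prod_j e j)%N by apply: prodn_gt0.
apply: dvdn_leq => //; apply: dvdn_prod_of_count => // t t_gt1.
pose A := [set i | ~~ (t %| d i)%N].
pose S := [set j | ~~ (t %| e j)%N].
have A0 : A != set0.
  apply/set0Pn/existsP; apply: contraLR t_gt1 => /existsPn td.
  rewrite -leqNgt dvdn_leq // -d_gcd.
  elim/big_rec: _ => [|i x _ tx]; first by rewrite dvdn0.
  by rewrite dvdn_gcd tx andbT; have := td i; rewrite inE negbK.
have hit j u : j \in S -> u \in msupp (f j) -> exists2 i, i \in A & u i != 0%N.
  (* A monomial avoiding [A] has weight divisible by [t], but that weight is [e j]. *)
  rewrite inE => tj /hf uj; apply/exists_inP; apply: contraR tj => /exists_inPn none.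
  rewrite -uj; apply: dvdn_sum => i _.
  have [ti|ti] := boolP (t %| d i)%N; first exact: dvdn_mull.
  by have := none i; rewrite inE ti negbK => /(_ isT)/eqP ->.
have le_m := leq_card_hit d_gt0 e_gt0 hf ker_f A0 hit.
have -> : (\sum_i (t %| d i) = #|~: A|)%N.
  rewrite -sum1_card [RHS]big_mkcond; apply: eq_bigr => i _.
  by rewrite !inE negbK; case: ifP.
have -> : (\sum_j (t %| e j) = #|~: S|)%N.
  rewrite -sum1_card [RHS]big_mkcond; apply: eq_bigr => j _.
  by rewrite !inE negbK; case: ifP.
(* Adding [#|A|] to both sides turns the goal into [le_m]. *)
by rewrite -(leq_add2l #|A|) cardsC card_ord.
Qed.

(** With positive [d i], weight 0 leaves only constants, and a nonzero constant is not a
    relation. *)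
Lemma relation_degree_gt0 (k : fieldType) m (d : 'I_m -> nat) n
    (q : {mpoly k[m]}) : (forall i, 0 < d i)%N ->
  q != 0 -> whomogeneous d n q -> semigroup_map d q = 0 -> (0 < n)%N.
Proof.
move=> d_gt0 q0 hq; rewrite lt0n; apply: contra_eq_neq.
move=> n0; subst n.
have qE : q = (q@_0%MM)%:MP.
  apply/mpolyP => u; rewrite mcoeffC; case: (eqVneq u 0%MM) => [->|u0].
    by rewrite mulr1.
  rewrite mulr0; apply: (mcoeff_whomogeneous hq); apply: contra u0 => /eqP u0.
  by rewrite -mdeg_eq0 -leqn0 -u0 mdeg_le_weight.
rewrite qE /semigroup_map mmapC polyC_eq0.
by apply: contra q0 => /eqP c0; rewrite qE c0 mpolyC0.
Qed.

Lemma rmorph_alt_power_sum (R S : comNzRingType) (h : {rmorphism R -> S}) N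
    (x : 'I_N -> R) n :
  h (alt_power_sum x n) = alt_power_sum (fun j => h (x j)) n.
Proof.
rewrite /alt_power_sum rmorph_sum; apply: eq_bigr => A _.
by rewrite rmorphM !rmorphXn rmorphN rmorph1 rmorph_sum.
Qed.

Theorem mainTheorem9 (k : fieldType) (m : nat) (d : 'I_m -> nat)
    (e : 'I_m.-1 -> nat) (hm : (2 <= m)%N) (hS : numerical_semigroup d)
    (hCI : complete_intersection k d e) (p : nat) :
  K d e p = (T m.-1 p.+1).@[fun j => (e j)%:R] / p.+1%:R.
Proof.
case: m d e hm hS hCI => // r d e _ [d_gt0 d_gcd _] [f [f0 hf ker_f]].
have ker_f' q : semigroup_map d q = 0 -> ideal_of f q by move/ker_f.
have e_gt0 j : (0 < e j)%N.
  apply: (relation_degree_gt0 d_gt0 (f0 j) (@hf j)); apply/ker_f.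
  exact: (ideal_of_gen f j).
have prod_de := prod_relation_degrees d_gt0 d_gcd e_gt0 hf ker_f'.
have fact_neq0 n : n`!%:R != 0 :> rat by rewrite Num.Theory.pnatr_eq0 -lt0n fact_gt0.
(* There are [r = m - 1] variables and the exponent is [m + p], hence the index [p.+1] of [T]. *)
have := congr1 (meval (fun j => (e j)%:R)) (T_factorization (ltnW (leq_addr p r.+1))).
rewrite rmorph_alt_power_sum /= mevalZ mevalM rmorph_prod /=.
have -> : (r.+1 + p - r = p.+1)%N by rewrite addSnnS addKn.
under [X in _ * (X * _)]eq_bigr do rewrite mevalXU.
rewrite (_ : alt_power_sum _ _ = CC e (r.+1 + p)); last first.
  apply: eq_bigr => A _; congr (_ * _ ^+ _).
  by apply: eq_bigr => j _; rewrite mevalXU.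
rewrite /K /pi_ -prod_de natr_prod => ->.
have e_neq0 : \prod_j (e j)%:R != 0 :> rat.
  by apply/prodf_neq0 => j _; rewrite Num.Theory.pnatr_eq0 -lt0n.
(* The divisor [p.+1] is what remains of [p.+1]![against]p[!]; the signs and the products cancel. *)
rewrite factS natrM; set t := (T r p.+1).@[_]; set P := \prod_j _ in e_neq0 *.
have s2 : (-1) ^+ r.+1 != 0 :> rat by rewrite signr_eq0.
have p1 : p.+1%:R != 0 :> rat by rewrite Num.Theory.pnatr_eq0.
move: (fact_neq0 p) (fact_neq0 (r.+1 + p)%N) s2 p1 e_neq0.
set a := _`!%:R; set c := _`!%:R; set s := (-1) ^+ _; set q := p.+1%:R.
move: a c s q P t => a c s q P t a0 c0 s0 q0 P0.
by field; rewrite s0 a0 c0 P0 q0.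
Qed.
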